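(* Let $R$ be a commutative Bézout domain (with $1\neq 0$) of stable range $1.5$, let $m\in R$ be nonzero and not a unit, let $R_m=R/mR$, and let $n\ge 2$. Let $$\Phi=\mathrm{diag}(1,\ldots,1,\varphi_t,\varphi_{t+1},\ldots,\varphi_k,0,\ldots,0)\in R_m^{n\times n},$$ where $1\le t\le k\le n$, the first $t-1$ diagonal entries are $1$, the last $n-k$ diagonal entries are $0$, $\varphi_t\mid\varphi_{t+1}\mid\cdots\mid\varphi_k\neq 0$ in $R_m$, and $\varphi_t\notin U(R_m)$. Let $\mathbf{G}_\Phi\le \mathrm{GL}_n(R_m)$ be the Zelisko group of $\Phi$. Then $\mathbf{G}_\Phi$ consists of all invertible matrices $H\in R_m^{n\times n}$ of the form: (i) $H=\begin{pmatrix} H_{11}&H_{12}&H_{13}\\ H_{21}&H_{22}&H_{23}\\ \mathbf{0}&H_{32}&H_{33}\end{pmatrix}$ if $1<t$ and $k<n$; (ii) $H=\begin{pmatrix} H_{22}&H_{23}\\ H_{32}&H_{33}\end{pmatrix}$ if $t=1$ and $k<n$; (iii) $H=H_{22}$ if $t=1$ and $k=n$; (iv) $H=\begin{pmatrix} H_{11}&H_{12}\\ H_{21}&H_{22}\end{pmatrix}$ if $1<t$ and $k=n$. Here the diagonal blocks $H_{11},H_{22},H_{33}$ have sizes $t-1$, $k-t+1$, $n-k$ respectively, the blocks $H_{11},H_{12},H_{13},H_{23},H_{33}$ are some (otherwise unrestricted) matrices over $R_m$ of the corresponding sizes, and $$H_{21}=\begin{bmatrix}\varphi_t h_{t1}&\varphi_t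 h_{t2}&\cdots&\varphi_t h_{t,t-1}\\ \varphi_{t+1}h_{t+1,1}&\varphi_{t+1}h_{t+1,2}&\cdots&\varphi_{t+1}h_{t+1,t-1}\\ \cdots&\cdots&\cdots&\cdots\\ \varphi_k h_{k1}&\varphi_k h_{k2}&\cdots&\varphi_k h_{k,t-1}\end{bmatrix},$$ $$H_{22}=\begin{bmatrix}h_{tt}&h_{t,t+1}&\cdots&h_{t,k-1}&h_{tk}\\ \widetilde{\frac{\varphi_{t+1}}{\varphi_t}}\,h_{t+1,t}&h_{t+1,t+1}&\cdots&h_{t+1,k-1}&h_{t+1,k}\\ \cdots&\cdots&\cdots&\cdots&\cdots\\ \widetilde{\frac{\varphi_k}{\varphi_t}}\,h_{kt}&\widetilde{\frac{\varphi_k}{\varphi_{t+1}}}\,h_{k,t+1}&\cdots&\widetilde{\frac{\varphi_k}{\varphi_{k-1}}}\,h_{k,k-1}&h_{kk}\end{bmatrix},$$ $$H_{32}=\begin{bmatrix}\alpha_t h_{k+1,t}&\alpha_{t+1}h_{k+1,t+1}&\cdots&\alpha_k h_{k+1,k}\\ \alpha_t h_{k+2,t}&\alpha_{t+1}h_{k+2,t+1}&\cdots&\alpha_k h_{k+2,k}\\ \vdots&\vdots&&\vdots\\ \alpha_t h_{nt}&\alpha_{t+1}h_{n,t+1}&\cdots&\alpha_k h_{nk}\end{bmatrix},$$ with $h_{ij}\in R_m$. (v) Moreover, if instead $\Phi=\mathrm{diag}(\underbrace{1,\ldots,1}_{s},\underbrace{0,\ldots,0}_{n-s})\in R_m^{n\times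 n}$ with $1\le s<n$, then $\mathbf{G}_\Phi$ consists of all invertible matrices of the form $H=\begin{pmatrix}M_{11}&M_{12}\\ \mathbf{0}&M_{22}\end{pmatrix}$ with $M_{11}\in\mathrm{GL}_s(R_m)$ and $M_{22}\in\mathrm{GL}_{n-s}(R_m)$.
   Context: A commutative Bézout domain is an integral domain in which every finitely generated ideal is principal. A ring $K$ has stable range $1.5$ if for all $a,b\in K$ and $c\in K\setminus\{0\}$ with $(a,b,c)=1$ there exists $r\in K$ such that $(a+br,c)=1$, where $(\cdot,\cdot)$ denotes the greatest common divisor. $U(K)$ denotes the group of units of a ring $K$; $a\mid b$ in a commutative ring means $b=ac$ for some element $c$ of the ring. Zelisko group: for a diagonal matrix $\Phi$ over $R_m$ as in the claim, $$\mathbf{G}_\Phi=\{H\in\mathrm{GL}_n(R_m)\mid \exists\, S\in\mathrm{GL}_n(R_m)\text{ such that }H\Phi=\Phi S\}.$$ Generating solutions: a generating solution of a solvable linear equation $ax=b$ in $R_m$ is a solution which divides all other solutions of the equation. It is known that every solvable equation $ax=b$ in $R_m$ has a generating solution, and that any two generating solutions of the same equation are associates. The elements $\widetilde{\frac{\varphi_p}{\varphi_q}}$ ($t\le q<p\le k$): for each $i=t,\ldots,k-1$ fix one generating solution of the equation $\varphi_i x=\varphi_{i+1}$ in $R_m$ and denote it by $\widetilde{\frac{\varphi_{i+1}}{\varphi_i}}$. For $p>q+1$ put $$\widetilde{\frac{\varphi_p}{\varphi_q}}:=\widetilde{\frac{\varphi_{q+1}}{\varphi_q}}\cdot\widetilde{\frac{\varphi_{q+2}}{\varphi_{q+1}}}\cdots\widetilde{\frac{\varphi_p}{\varphi_{p-1}}}.$$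 The elements $\alpha_j$ ($t\le j\le k$): it is known that each $\varphi_j$ can be written as $\varphi_j=\overline{\mu}_j e_j$, where $\overline{\mu}_j$ is the image in $R_m$ of $\mu_j:=(c_j,m)\in R$ for a preimage $c_j\in R$ of $\varphi_j$, and $e_j\in U(R_m)$. Fix such a representation and let $\alpha_j\in R_m$ be the image of $m/\mu_j$ in $R_m$ multiplied by $e_j$; then $\alpha_jR_m=\mathrm{Ann}(\varphi_j)=\{x\in R_m: x\varphi_j=0\}$. *)

(* Defs.v *)
From HB Require Import structures.
From mathcomp Require Import all_boot all_order all_algebra zify.
From mathcomp Require Import generic_quotient ring_quotient boolp.
Set Implicit Arguments.
Unset Strict Implicit.
Unset Printing Implicit Defensive.
Import GRing.Theory.
Local Open Scope ring_scope.
Local Open Scope quotient_scope.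

Definition divides (K : comNzRingType) (a b : K) : Prop := exists c, b = a * c.

(* [is_gcd d s] reads "d is a greatest common divisor of s"; gcds are only
   determined up to units, so (a, b, c) = 1 is [is_gcd 1 [:: a; b; c]]. *)
Definition is_gcd (K : comNzRingType) (d : K) (s : seq K) : Prop :=
  (forall x, x \in s -> divides d x) /\
  (forall d', (forall x, x \in s -> divides d' x) -> divides d' d).

Definition bezout (K : comNzRingType) : Prop :=
  forall (n : nat) (a : 'I_n -> K), exists d : K, forall x : K,
    (exists u : 'I_n -> K, x = \sum_i u i * a i) <-> (exists u, x = u * d).

Definition stable_range_1_5 (K : comNzRingType) : Prop :=
  forall a b c : K, c != 0 -> is_gcd 1 [:: a; b; c] ->
    exists r, is_gcd 1 [:: a + b * r; c].

Section QuotientRing.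
Variables (R : idomainType) (m : R).

(* The proof argument is unused in the body; it is what makes mR a proper
   ideal, as the library's ring quotients require. *)
Definition multiples (mU : m \isn't a GRing.unit) : {pred R} :=
  fun x => `[< divides m x >].

Variable mU : m \isn't a GRing.unit.

Lemma multiples_idealr : idealr_closed (multiples mU).
Proof.
split.
- by apply/asboolP; exists 0; rewrite mulr0.
- apply/asboolP => -[c c1]; move/negP: mU; apply.
  by apply/unitrPr; exists c.
- move=> a u v /asboolP[c ->] /asboolP[d ->]; apply/asboolP.
  by exists (a * c + d); rewrite mulrDr mulrCA.
Qed.

HB.instance Definition _ := isIdealr.Build R (multiples mU) multiples_idealr.

Definition Rmod := {ideal_quot (multiples mU)}.
HB.instance Definition _ := GRing.ComNzRing.on Rmod.

Definition toRmod (x : R) : Rmod := \pi_{ideal_quot (multiples mU)} x.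

Lemma toRmod_zmod_morphism : zmod_morphism toRmod.
Proof. exact: rmorphB. Qed.
Lemma toRmod_monoid_morphism : monoid_morphism toRmod.
Proof. by split; [exact: rmorph1 | exact: rmorphM]. Qed.
HB.instance Definition _ :=
  GRing.isZmodMorphism.Build R Rmod toRmod toRmod_zmod_morphism.
HB.instance Definition _ :=
  GRing.isMonoidMorphism.Build R Rmod toRmod toRmod_monoid_morphism.

Lemma toRmod_eq0 (x : R) : toRmod x = 0 <-> divides m x.
Proof.
rewrite -(rmorph0 toRmod); split=> [/eqP|mx].
  by rewrite -Quotient.idealrBE subr0 => /asboolP.
by apply/eqP; rewrite -Quotient.idealrBE subr0; apply/asboolP.
Qed.

Lemma toRmod_surj (y : Rmod) : exists x : R, toRmod x = y.
Proof. by exists (repr y); rewrite /toRmod reprK. Qed.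

Definition Rmod_unit : {pred Rmod} := fun x => `[< exists y : Rmod, y * x = 1 >].
Definition Rmod_inv (x : Rmod) : Rmod :=
  if pselect (exists y : Rmod, y * x = 1) is left e then sval (cid e) else x.

Lemma Rmod_mulVx : {in Rmod_unit, left_inverse 1 Rmod_inv *%R}.
Proof.
move=> x /asboolP xU; rewrite /Rmod_inv; case: pselect => // e.
exact: svalP (cid e).
Qed.

Lemma Rmod_unitPl (x y : Rmod) : y * x = 1 -> Rmod_unit x.
Proof. by move=> yx; apply/asboolP; exists y. Qed.

Lemma Rmod_inv_out : {in [predC Rmod_unit], Rmod_inv =1 id}.
Proof.
move=> x /asboolPn xU; rewrite /Rmod_inv.
by case: pselect => // e; case: (xU e).
Qed.

HB.instance Definition _ := GRing.ComNzRing_hasMulInverse.Build Rmod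
  Rmod_mulVx Rmod_unitPl Rmod_inv_out.

End QuotientRing.

Definition zelisko (Q : comUnitRingType) (n : nat) (Phi H : 'M[Q]_n) : Prop :=
  H \in unitmx /\ exists2 S : 'M[Q]_n, S \in unitmx & H *m Phi = Phi *m S.

Definition generating_solution (Q : comNzRingType) (a b x : Q) : Prop :=
  a * x = b /\ forall y, a * y = b -> divides x y.

(* [a] is a generator of Ann(f) built from a representation f = mu * e, where
   mu = (c, m) for a preimage c of f and e is a unit; the cofactor nu is m / mu,
   which is determined by mu when m != 0. *)
Definition ann_generator (R : idomainType) (m : R)
    (mU : m \isn't a GRing.unit) (f a : Rmod mU) : Prop :=
  exists (c mu nu : R) (e : Rmod mU),
    [/\ toRmod mU c = f, is_gcd mu [:: c; m] & m = mu * nu] /\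
    [/\ e \is a GRing.unit, f = toRmod mU mu * e & a = toRmod mU nu * e].

(* Families such as phi_t, ..., phi_k and h_ij are functions of 1-based natural
   number indices, of which only the values in the relevant range are used;
   matrix row and column indices i : 'I_n are 0-based. *)
Section Blocks.
Variables (Q : comUnitRingType) (n t k : nat).

Definition Phi_mx (phi : nat -> Q) : 'M[Q]_n :=
  diag_mx (\row_(i < n) if (i.+1 < t)%N then 1
                        else if (i.+1 <= k)%N then phi i.+1 else 0).

(* The product of the chosen generating solutions g i of
   phi_i x = phi_(i+1), for q <= i < p. *)
Definition phi_quot (g : nat -> Q) (p q : nat) : Q := \prod_(q <= i < p) g i.

Definition block21 (phi : nat -> Q) (h : nat -> nat -> Q) :
    'M[Q]_(k - t + 1, t - 1) :=
  \matrix_(i, j) (phi (t + i)%N * h (t + i)%N j.+1).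

Definition block22 (g : nat -> Q) (h : nat -> nat -> Q) : 'M[Q]_(k - t + 1) :=
  \matrix_(i, j)
    if (i <= j)%N then h (t + i)%N (t + j)%N
    else phi_quot g (t + i) (t + j) * h (t + i)%N (t + j)%N.

Definition block32 (alpha : nat -> Q) (h : nat -> nat -> Q) :
    'M[Q]_(n - k, k - t + 1) :=
  \matrix_(i, j) (alpha (t + j)%N * h (k + i.+1)%N (t + j)%N).

End Blocks.

Definition castsq (Q : comUnitRingType) (p n : nat) (E : p = n) (A : 'M[Q]_p) :
  'M[Q]_n := castmx (E, E) A.

Lemma size_i n t k : (1 < t -> t <= k -> k < n ->
  t - 1 + (k - t + 1 + (n - k)) = n)%N.
Proof. lia. Qed.

Lemma size_ii n t k : (t = 1 -> t <= k -> k < n ->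
  k - t + 1 + (n - k) = n)%N.
Proof. lia. Qed.

Lemma size_iii n t k : (t = 1 -> t <= k -> k = n -> k - t + 1 = n)%N.
Proof. lia. Qed.

Lemma size_iv n t k : (1 < t -> t <= k -> k = n ->
  t - 1 + (k - t + 1) = n)%N.
Proof. lia. Qed.

Lemma size_v n s : (s < n -> s + (n - s) = n)%N.
Proof. lia. Qed.

(* Main.v *)
(* If [H Phi = Phi S] with [H] invertible, then [H^-1] is a polynomial in [H] by
   Cayley-Hamilton, whence [H^-1 Phi = Phi T] and [Phi (1 - S T) = 0].  The ring
   R_m has stable range 1 because R is Bezout of stable range 1.5, and so do its
   matrix rings; hence [S + (1 - S T) Z] is invertible for some [Z], and it may
   replace [S].  So invertibility of [S] is no constraint, and for diagonal [Phi]
   membership in the Zelisko group is the entrywise divisibility of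
   [H i j * phi_j] by [phi_i].  Each of these conditions says that a fixed
   multiplier divides [H i j]; below the diagonal this holds because a generating
   solution of [phi_i x = phi_(i+1)] divides the annihilator of [phi_i]. *)
Require Import Defs.
From HB Require Import structures.
From mathcomp Require Import all_boot all_order all_algebra.
From mathcomp Require Import zify ring.
Import GRing.Theory.
Local Open Scope ring_scope.

(** * Stable range 1, for matrices and for [Rmod] *)

Lemma mx_linE (Q : pzRingType) (m n : nat) (i : 'I_m) (j : 'I_n) :
  (forall A B : 'M[Q]_(m, n), (A + B) i j = A i j + B i j) *
  (forall A : 'M[Q]_(m, n), (- A) i j = - A i j) *
  (forall c (A : 'M[Q]_(m, n)), (c *: A) i j = c * A i j).
Proof. by split=> [|c A]; [split=> [A B|A] |]; rewrite mxE. Qed.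

(* The [ring] tactic does not apply to rectangular matrices; linear identities
   between them are checked entrywise, with products as atoms. *)
Ltac mx_ring := apply/matrixP => ? ?; rewrite !mx_linE; ring.

(** Comaximality of [a] and [b] is given by explicit coefficients, which is what an entry of a
    matrix identity [A *m Y + B *m W = 1%:M] supplies. *)
Definition stable_range_1 (Q : comUnitRingType) : Prop :=
  forall a b x y : Q, a * x + b * y = 1 -> exists r, a + b * r \is a GRing.unit.

(* Adding to the first column of [A] combinations of its other columns and of the
   columns of [B] makes the corner entry a unit [u]; clearing the column below
   [u] leaves a right-invertible pair of size one less. *)
Lemma stable_range_1_mx (Q : comUnitRingType) (m l : nat)
    (A Y : 'M[Q]_m) (B : 'M[Q]_(m, l)) (W : 'M[Q]_(l, m)) :
  stable_range_1 Q -> A *m Y + B *m W = 1%:M ->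
  exists Z : 'M[Q]_(l, m), A + B *m Z \in unitmx.
Proof.
move=> sr1; elim: m => [|m IHm] in A Y B W *.
  by move=> _; exists 0; rewrite unitmxE det_mx00 unitr1.
rewrite -[m.+1]/(1 + m)%N in A Y B W *.
rewrite -(submxK A) -(submxK Y) -(vsubmxK B) -(hsubmxK W).
move: (ulsubmx A) (ursubmx A) (dlsubmx A) (drsubmx A) => a a' c D.
move: (ulsubmx Y) (ursubmx Y) (dlsubmx Y) (drsubmx Y) => y y' z z'.
move: (usubmx B) (dsubmx B) (lsubmx W) (rsubmx W) => b B' w W' {A Y B W}.
rewrite mulmx_block mul_col_row add_block_mx scalar_mx_block.
move=> /eq_block_mx [e11 e12 e21 e22].
pose p := a' *m z + b *m w.
(* The corner of the identity reads [a * y + p = 1], so stable range 1 applies to [a] and [p] with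
   second coefficient 1. *)
have [r ru] : exists r, a 0 0 + p 0 0 * r \is a GRing.unit.
  apply: (sr1 _ _ (y 0 0) 1); rewrite mulr1.
  have -> : a 0 0 * y 0 0 = (a *m y) 0 0 by rewrite mxE big_ord1.
  move/matrixP/(_ 0 0): e11; rewrite -addrA -/p [RHS]mxE eqxx => e.
  by rewrite -[RHS]e [RHS]mxE.
set u := _ + _ in ru.
have aE : a + r *: p = u%:M.
  by rewrite [LHS]mx11_scalar; congr _%:M; rewrite !mxE [r * _]mulrC /u !mxE.
(* [c1] is what the column operation that turns [a] into [u] makes of [c]; subtracting [V] times the
   top row clears it. *)
pose c1 := c + r *: (D *m z + B' *m w).
pose V := u^-1 *: c1.
have Vu : V *m u%:M = c1 by rewrite mul_mx_scalar scalerA mulrV ?scale1r.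
(* The new coefficients come from applying the inverse column operation to the stacked [Y] and [W]
   and keeping the last [m] columns. *)
have [|Z ZU] := IHm (D - V *m a') (z' - r *: (z *m y')) (B' - V *m b)
                   (W' - r *: (w *m y')).
  have e12' : a' *m z' + b *m W' = - (a *m y').
    by apply/eqP; rewrite -addr_eq0 [_ + a *m y']addrC addrA e12.
  have e22' : D *m z' + B' *m W' = 1%:M - c *m y'.
    by rewrite -e22 [RHS]addrC !addrA addNr add0r.
  have -> : (D - V *m a') *m (z' - r *: (z *m y')) +
            (B' - V *m b) *m (W' - r *: (w *m y')) =
            (D *m z' + B' *m W') - V *m (a' *m z' + b *m W')
            - (c1 - c) *m y' + V *m (r *: p) *m y'.
    rewrite /c1 [c + _]addrC addrK /p !(mulmxBl, mulmxBr, mulmxDr, mulmxDl).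
    rewrite -!(scalemxAr, scalemxAl) !(mulmxDr, mulmxDl, scalerDr, mulmxA).
    by rewrite !opprD !opprK; mx_ring.
  rewrite e12' e22' mulmxN opprK !mulmxBl mulmxA.
  have -> : r *: p = u%:M - a by rewrite -aE addrC addKr.
  by rewrite mulmxBr Vu mulmxBl; mx_ring.
(* The term [- Z *m z] cancels the contribution of [Z] when [U] adds [r *: z] times the right
   columns to the first, so the corner becomes exactly [u]. *)
exists (row_mx (r *: (w - Z *m z)) Z).
rewrite mul_col_row add_block_mx.
pose U : 'M[Q]_(1 + m) := block_mx 1%:M 0 (r *: z) 1%:M.
pose L : 'M[Q]_(1 + m) := block_mx 1%:M 0 (- V) 1%:M.
set M := block_mx _ _ _ _.
have /(congr1 (fun X => \det X)) : L *m (M *m U) =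
    block_mx u%:M (a' + b *m Z) 0 (D - V *m a' + (B' - V *m b) *m Z).
  have -> : M *m U = block_mx u%:M (a' + b *m Z) c1 (D + B' *m Z).
    rewrite /M /U mulmx_block !mulmx0 !add0r !mulmx1 -aE /c1 /p.
    rewrite -!scalemxAr !(mulmxBr, mulmxBl, scalerBr, mulmxDr, mulmxDl, scalerDr) !mulmxA.
    by congr block_mx; mx_ring.
  rewrite /L mulmx_block !mul0mx !addr0 !mul1mx !mulNmx Vu addNr.
  congr block_mx; rewrite mulmxDr mulmxBl !mulmxA; mx_ring.
rewrite !det_mulmx det_ublock !det_lblock !det1 !mul1r mulr1 => detM.
by rewrite unitmxE detM det_scalar1 unitrM ru -unitmxE.
Qed.

(** Lifting [a * x + b * y = 1] to [R] shows that the lifts of [a] and [b] have gcd 1 together with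
    [m]. Stable range 1.5 with [c = m] gives [r] with [a + b * r] coprime to [m], hence invertible
    modulo [m] by the Bezout property. *)
Lemma stable_range_1_Rmod (R : idomainType) (m : R)
    (mU : m \isn't a GRing.unit) :
  bezout R -> stable_range_1_5 R -> m != 0 -> stable_range_1 (Rmod mU).
Proof.
move=> hbez hsr m0 a b x y.
have [a' <-] := toRmod_surj a; have [b' <-] := toRmod_surj b.
have [x' <-] := toRmod_surj x; have [y' <-] := toRmod_surj y => e.
have [z ez] : divides m (a' * x' + b' * y' - 1).
  by apply/(toRmod_eq0 mU); rewrite rmorphB rmorphD !rmorphM rmorph1 /= e subrr.
have g1 : is_gcd 1 [:: a'; b'; m].
  split=> [w _|d dvd_d]; first by exists w; rewrite mul1r.
  have [|a1 a1E] := dvd_d a'; first by rewrite !inE eqxx.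
  have [|b1 b1E] := dvd_d b'; first by rewrite !inE eqxx orbT.
  have [|m1 m1E] := dvd_d m; first by rewrite !inE eqxx !orbT.
  exists (a1 * x' + b1 * y' - m1 * z).
  have -> : (1 : R) = a' * x' + b' * y' - m * z by rewrite -ez; ring.
  by rewrite {1}a1E {1}b1E {1}m1E; ring.
have [r [_ rP]] := hsr _ _ _ m0 g1.
(* [is_gcd] speaks of common divisors only. The generator [d] of the ideal is one, so it divides 1
   and the ideal contains 1. *)
have [d dP] := hbez 2%N (fun i : 'I_2 => if i == 0 then a' + b' * r else m).
have dvd_d i : exists u, (if i == 0 :> 'I_2 then a' + b' * r else m) = u * d.
  apply/dP; exists (fun j => (j == i)%:R).
  rewrite (bigD1 i) //= eqxx mul1r big1 ?addr0 // => j /negPf ->.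
  by rewrite mul0r.
have [|w dw] := rP d.
  move=> v; rewrite !inE => /orP[] /eqP ->.
    by have [u uE] := dvd_d 0; exists u; rewrite [RHS]mulrC -uE.
  by have [u uE] := dvd_d 1; exists u; rewrite [RHS]mulrC -uE.
have [u uE] : exists u : 'I_2 -> R,
    1 = \sum_i u i * (if i == 0 then a' + b' * r else m).
  by apply/dP; exists w; rewrite mulrC.
exists (toRmod mU r); apply/unitrPr; exists (toRmod mU (u 0)).
move/(congr1 (toRmod mU)): uE; rewrite big_ord_recl big_ord1 /=.
rewrite rmorphD !rmorphM rmorph1 rmorphD rmorphM /=.
have -> : toRmod mU m = 0 by apply/toRmod_eq0; exists 1; rewrite mulr1.
by rewrite mulr0 addr0 mulrC => <-.
Qed.

(** * The Zelisko group as a set of divisibility conditions *)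

Lemma horner_mx_intertwine (Q : comNzRingType) (n : nat)
    (Phi H S : 'M[Q]_n.+1) (p : {poly Q}) :
  H *m Phi = Phi *m S -> horner_mx H p *m Phi = Phi *m horner_mx S p.
Proof.
move=> HS; elim/poly_ind: p => [|p c IHp].
  by rewrite !rmorph0 mul0mx mulmx0.
rewrite !rmorphD !rmorphM /= !horner_mx_X !horner_mx_C mulmxDl mulmxDr.
rewrite -!mulmxE -mulmxA HS !mulmxA IHp; congr (_ + _).
by rewrite mul_scalar_mx mul_mx_scalar.
Qed.

(* By Cayley-Hamilton the inverse of [H] is a polynomial in [H]. *)
Lemma invmx_intertwine (Q : comUnitRingType) (n : nat) (Phi H S : 'M[Q]_n) :
  H \in unitmx -> H *m Phi = Phi *m S ->
  exists T : 'M[Q]_n, invmx H *m Phi = Phi *m T.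
Proof.
case: n Phi H S => [|n] Phi H S HU HS; first by exists 0; apply/matrixP => -[].
(* The constant term [c] is the determinant up to sign, a unit; so [q(H) H + c = 0] gives the
   inverse of [H] as [- c^-1] times [q(H)]. *)
have [q [c pE]] : exists q c, char_poly H = q * 'X + c%:P.
  elim/poly_ind: (char_poly H) => [|q c _]; last by exists q, c.
  by exists 0, 0; rewrite mul0r addr0.
have cE : c = (-1) ^+ n.+1 * \det H.
  by rewrite -char_poly_det pE coefD coefC coefMX add0r.
have cU : c \is a GRing.unit by rewrite cE unitrM unitrX ?unitrN1 -?unitmxE.
exists (- c^-1 *: horner_mx S q).
have -> : invmx H = - c^-1 *: horner_mx H q.
  apply: (mulIr (x := H)); first by [].
  have := Cayley_Hamilton H; rewrite pE rmorphD rmorphM /= horner_mx_X horner_mx_C.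
  move/eqP; rewrite addr_eq0 => /eqP qH.
  rewrite -!mulmxE mulVmx // -scalemxAl mulmxE qH.
  by rewrite scalerN scaleNr opprK -mul_scalar_mx -scalar_mxM mulVr.
by rewrite -scalemxAl (horner_mx_intertwine _ _ _ _ _ q HS) scalemxAr.
Qed.

Lemma zelisko_intertwine (Q : comUnitRingType) (n : nat) (Phi H : 'M[Q]_n) :
  stable_range_1 Q ->
  zelisko Phi H <-> H \in unitmx /\ exists S, H *m Phi = Phi *m S.
Proof.
move=> sr1; split=> [[HU [S _ HS]]|[HU [S HS]]]; split=> //; first by exists S.
have [T HT] := invmx_intertwine _ _ _ _ _ HU HS.
have PhiST : Phi *m (1%:M - S *m T) = 0.
  by rewrite mulmxBr mulmx1 mulmxA -HS -mulmxA -HT mulKVmx // subrr.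
(* The pair [S], [1 - S T] is comaximal with coefficients [T] and 1; multiples of the second are
   killed by [Phi]. *)
have [|Z ZU] := @stable_range_1_mx _ _ _ S T (1%:M - S *m T) 1%:M sr1.
  by rewrite mulmx1 addrC subrK.
exists (S + (1%:M - S *m T) *m Z) => //.
by rewrite mulmxDr mulmxA PhiST mul0mx addr0.
Qed.

(** For diagonal [Phi] the equation [H Phi = Phi S] decouples, so with no invertibility left to ask,
    [S] can be chosen one entry at a time. *)
Lemma zelisko_diag (Q : comUnitRingType) (n : nat) (d : 'rV[Q]_n) (H : 'M[Q]_n) :
  stable_range_1 Q ->
  zelisko (diag_mx d) H <->
  H \in unitmx /\ forall i j, divides (d 0 i) (H i j * d 0 j).
Proof.
move=> sr1; rewrite zelisko_intertwine //; split=> -[HU] => [[S HS]|dvdH]; split=> //.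
  move=> i j; exists (S i j).
  by move/matrixP/(_ i j): HS; rewrite mul_mx_diag mul_diag_mx !mxE.
have /boolp.choice [f fP] (ij : 'I_n * 'I_n) :
    exists x, H ij.1 ij.2 * d 0 ij.2 = d 0 ij.1 * x by exact: dvdH.
exists (\matrix_(i, j) f (i, j)); apply/matrixP => i j.
by rewrite mul_mx_diag mul_diag_mx !mxE (fP (i, j)).
Qed.

(** * Annihilators, generating solutions and the multiplier of each entry *)

(** After the unit [e] is removed, [x * f = 0] lifts to [x' * mu = mu * nu * y] in the domain [R],
    where [mu] is nonzero as a divisor of [m] and cancels. *)
Lemma ann_generatorP (R : idomainType) (m : R) (mU : m \isn't a GRing.unit)
    (f a x : Rmod mU) :
  m != 0 -> ann_generator f a -> x * f = 0 <-> divides a x.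
Proof.
move=> m0 [c [mu [nu [e [[_ _ mE] [eU fE aE]]]]]]; rewrite fE aE; split.
  have [x' <-] := toRmod_surj x; rewrite mulrA -rmorphM => /(canRL (mulrK eU)).
  rewrite mul0r => /toRmod_eq0 [y yE].
  have mu0 : mu != 0 by apply: contraNneq m0 => mu0; rewrite mE mu0 mul0r.
  have -> : x' = nu * y by apply: (mulfI mu0); rewrite mulrC yE {1}mE mulrA.
  exists (e^-1 * toRmod mU y).
  by rewrite rmorphM -mulrA mulVKr.
case=> y ->; have : toRmod mU (mu * nu) = 0.
  by apply/toRmod_eq0; exists 1; rewrite mulr1 mE.
rewrite rmorphM => munu.
transitivity ((toRmod mU mu * toRmod mU nu) * (e * e * y)); first by ring.
by rewrite munu mul0r.
Qed.

Section ZeliskoCoef.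
Variables (Q : comUnitRingType) (t k : nat) (phi g alpha : nat -> Q).
Hypothesis phi_gen : forall i, (t <= i < k)%N ->
  generating_solution (phi i) (phi i.+1) (g i).
Hypothesis ann_phi : forall j x, (t <= j <= k)%N ->
  x * phi j = 0 <-> divides (alpha j) x.

Lemma phi_quotE q p : (t <= q)%N -> (q <= p)%N -> (p <= k)%N ->
  phi q * phi_quot g p q = phi p.
Proof.
move=> tq; rewrite /phi_quot; elim: p => [|p IHp] qp pk.
  by rewrite (_ : q = 0%N) ?big_geq ?mulr1 //; lia.
have [qp'|qp'] := leqP q p; last first.
  by rewrite (_ : q = p.+1) ?big_geq ?mulr1 //; lia.
rewrite big_nat_recr //= mulrA IHp //; last by lia.
by have [|-> _] := phi_gen p; first lia.
Qed.

(* Adding an element of [Ann (phi i)] to a solution of [phi i * x = phi i.+1]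
   gives another solution, so a generating solution divides [Ann (phi i)]. *)
Lemma dvd_phi_quot q p x : (t <= q)%N -> (q <= p)%N -> (p <= k)%N ->
  divides (phi p) (x * phi q) <-> divides (phi_quot g p q) x.
Proof.
move=> tq qp pk; split=> [|[y ->]]; last first.
  by exists y; rewrite -(phi_quotE _ _ tq qp pk); ring.
have [l pE] : exists l, p = (q + l)%N by exists (p - q)%N; lia.
elim: l q x tq qp pE => [|l IHl] q x tq qp pE [y yE].
  by exists x; rewrite /phi_quot big_geq ?mul1r //; lia.
have [|gE g_min] := phi_gen q; first lia.
have [q_p tq1 pE1] : [/\ q.+1 <= p, t <= q.+1 & p = q.+1 + l]%N by split; lia.
have e1 := phi_quotE _ _ tq1 q_p pk.
(* Both [x] and [g q * w] are taken to [phi p * y] by [phi q], so their difference lies in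
   [Ann (phi q)]. *)
pose w := phi_quot g p q.+1 * y.
have ann : phi q * (x - g q * w) = 0.
  by rewrite mulrBr mulrA gE /w mulrA e1 -yE mulrC subrr.
have [z zE] : divides (g q) (g q + (x - g q * w)).
  by apply: g_min; rewrite mulrDr ann addr0.
(* With one factor [g q] split off, the induction hypothesis at [q.+1] applies to the cofactor. *)
have xE : x = g q * (z - 1 + w) by rewrite mulrDr mulrBr -zE; ring.
have [|v vE] := IHl q.+1 (z - 1 + w) tq1 q_p pE1.
  by exists y; rewrite -yE xE -gE; ring.
by exists v; rewrite xE vE /phi_quot [in RHS]big_ltn // mulrA.
Qed.

(* The multiplier which the block forms prescribe for the entry [(p, q)], with
   1-based indices; note that [phi_quot g p q = 1] for [p <= q]. *)
Definition zcoef (p q : nat) : Q :=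
  if (p < t)%N then 1
  else if (p <= k)%N then if (q < t)%N then phi p else phi_quot g p q
  else if (q < t)%N then 0 else if (q <= k)%N then alpha q else 1.

Definition Phi_entry (p : nat) : Q :=
  if (p < t)%N then 1 else if (p <= k)%N then phi p else 0.

(** The cases follow the blocks. Inside the middle block, generating solutions decide below the
    diagonal; in the bottom rows the divisor is 0, so the product itself must vanish. *)
Lemma dvd_zcoef p q x :
  divides (Phi_entry p) (x * Phi_entry q) <-> divides (zcoef p q) x.
Proof.
have dvd1 (y : Q) : divides 1 y by exists y; rewrite mul1r.
have dvd0 (y : Q) : divides y 0 by exists 0; rewrite mulr0.
have dvd0E (y : Q) : divides 0 y <-> y = 0.
  by split=> [[z]|->]; first rewrite mul0r.
rewrite /Phi_entry /zcoef; case: ltnP => [//|tp].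
have [pk|kp] := leqP p k; have [qt|tq] := ltnP q t; rewrite ?mulr1 //.
- have [qk|kq] := leqP q k; last first.
    by rewrite mulr0 /phi_quot big_geq //; lia.
  have [qp|pq] := leqP q p; first exact: dvd_phi_quot.
  rewrite [phi_quot _ _ _]big_geq; last by lia.
  (* Above the diagonal [phi p] divides [phi q], so there is no condition on [x]. *)
  split=> // _; exists (phi_quot g q p * x).
  by rewrite mulrA phi_quotE // ?(ltnW pq) // mulrC.
- have [qk|kq] := leqP q k; last by rewrite mulr0.
  by rewrite dvd0E ann_phi ?tq.
Qed.

End ZeliskoCoef.

Lemma zelisko_Phi (Q : comUnitRingType) (n t k : nat) (phi g alpha : nat -> Q)
    (H : 'M[Q]_n) :
  stable_range_1 Q ->
  (forall i, (t <= i < k)%N -> generating_solution (phi i) (phi i.+1) (g i)) ->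
  (forall j x, (t <= j <= k)%N -> x * phi j = 0 <-> divides (alpha j) x) ->
  zelisko (Phi_mx n t k phi) H <->
  H \in unitmx /\
  forall i j : 'I_n, divides (zcoef Q t k phi g alpha i.+1 j.+1) (H i j).
Proof.
move=> sr1 phi_gen ann_phi; rewrite zelisko_diag //.
have dvdE i j := dvd_zcoef Q t k phi g alpha phi_gen ann_phi i j.
split=> -[HU dvdH]; split=> // i j.
  by apply/dvdE; have := dvdH i j; rewrite !mxE.
by rewrite !mxE; exact: (proj2 (dvdE i.+1 j.+1 _) (dvdH i j)).
Qed.

(** * Entrywise conditions on block matrices *)

(** With indices in [nat], a condition passes through a cast unchanged and to a block by adding an
    offset. *)
Definition mx_all {Q : comUnitRingType} {m n} (P : nat -> nat -> Q -> Prop)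
    (A : 'M[Q]_(m, n)) : Prop :=
  forall (i : 'I_m) (j : 'I_n), P i j (A i j).

Section Entrywise.
Variable Q : comUnitRingType.
Implicit Type P : nat -> nat -> Q -> Prop.

Lemma mx_all_castsq p n (E : p = n) P (A : 'M[Q]_p) :
  mx_all P (castsq E A) <-> mx_all P A.
Proof. by case: n / E; rewrite /castsq castmx_id. Qed.

Lemma castsq_surj p n (E : p = n) (H : 'M[Q]_n) : exists A, H = castsq E A.
Proof. by case: n / E in H *; exists H; rewrite /castsq castmx_id. Qed.

Lemma unitmx_castsq p n (E : p = n) (A : 'M[Q]_p) :
  (castsq E A \in unitmx) = (A \in unitmx).
Proof. by case: n / E; rewrite /castsq castmx_id. Qed.

Lemma mx_all_row m n1 n2 P (A : 'M[Q]_(m, n1)) (B : 'M[Q]_(m, n2)) :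
  mx_all P (row_mx A B) <->
  mx_all P A /\ mx_all (fun i j => P i (n1 + j)%N) B.
Proof.
split=> [PAB|[PA PB] i j].
  split=> i j.
    by have := PAB i (lshift n2 j); rewrite row_mxEl.
  by have := PAB i (rshift n1 j); rewrite row_mxEr.
by case: (split_ordP j) => {}j ->; rewrite ?row_mxEl ?row_mxEr;
  [apply: PA | apply: PB].
Qed.

Lemma mx_all_col m1 m2 n P (A : 'M[Q]_(m1, n)) (B : 'M[Q]_(m2, n)) :
  mx_all P (col_mx A B) <->
  mx_all P A /\ mx_all (fun i => P (m1 + i)%N) B.
Proof.
split=> [PAB|[PA PB] i j].
  split=> i j.
    by have := PAB (lshift m2 i) j; rewrite col_mxEu.
  by have := PAB (rshift m1 i) j; rewrite col_mxEd.
by case: (split_ordP i) => {}i ->; rewrite ?col_mxEu ?col_mxEd;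
  [apply: PA | apply: PB].
Qed.

Lemma mx_all_block m1 m2 n1 n2 P (A : 'M[Q]_(m1, n1)) (B : 'M[Q]_(m1, n2))
    (C : 'M[Q]_(m2, n1)) (D : 'M[Q]_(m2, n2)) :
  mx_all P (block_mx A B C D) <->
  (mx_all P A /\ mx_all (fun i j => P i (n1 + j)%N) B) /\
  (mx_all (fun i => P (m1 + i)%N) C /\
   mx_all (fun i j => P (m1 + i)%N (n1 + j)%N) D).
Proof. by rewrite /block_mx mx_all_col !mx_all_row. Qed.

(** All cofactors are collected in one family [h], since the blocks of the normal form share it. *)
Lemma divides_factor n (c : nat -> nat -> Q) (H : 'M[Q]_n) :
  mx_all (fun i j => divides (c i.+1 j.+1)) H ->
  exists h, mx_all (fun i j x => x = c i.+1 j.+1 * h i.+1 j.+1) H.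
Proof.
move=> dvdH.
have /boolp.choice [f fP] (ij : 'I_n * 'I_n) :
    exists y, H ij.1 ij.2 = c ij.1.+1 ij.2.+1 * y by exact: dvdH.
(* [pick] recovers the ordinals from 1-based indices; outside the matrix the value is 0. *)
exists (fun p q => if [pick ij : 'I_n * 'I_n | (ij.1.+1 == p) && (ij.2.+1 == q)]
                   is Some ij then f ij else 0) => i j.
case: pickP => [[i' j'] /andP[/= /eqP[/val_inj <-] /eqP[/val_inj <-]] | /(_ (i, j))].
  exact: (fP (i', j')).
by rewrite /= !eqxx.
Qed.

End Entrywise.

(** * The block forms (i) to (iv) *)

Section ZeliskoBlocks.
Variables (Q : comUnitRingType) (n t k : nat) (phi g alpha : nat -> Q).
Hypotheses (t_gt0 : (1 <= t)%N) (le_tk : (t <= k)%N) (le_kn : (k <= n)%N).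
Hypothesis phi_gen : forall i, (t <= i < k)%N ->
  generating_solution (phi i) (phi i.+1) (g i).
Hypothesis ann_phi : forall j x, (t <= j <= k)%N ->
  x * phi j = 0 <-> divides (alpha j) x.
Hypothesis sr1 : stable_range_1 Q.

Local Notation zc := (zcoef Q t k phi g alpha).

(** This accounts for the unrestricted blocks [H11], [H12], [H13], [H23] and [H33]; in the middle
    rows the product of quotients is empty. *)
Lemma zcoef_free p q : (p < t)%N || (k < q)%N -> zc p q = 1.
Proof.
rewrite /zcoef; case: ltnP => //= tp kq.
have -> : (q < t)%N = false by lia.
have -> : (q <= k)%N = false by lia.
by case: leqP => // pk; rewrite /phi_quot big_geq //; lia.
Qed.

Lemma dvd_zcoef_free p q x : (p < t)%N || (k < q)%N -> divides (zc p q) x.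
Proof. by move=> pq; rewrite zcoef_free //; exists x; rewrite mul1r. Qed.

Lemma block21E h (i : 'I_(k - t + 1)) (j : 'I_(t - 1)) :
  block21 t k phi h i j = zc (t + i)%N j.+1 * h (t + i)%N j.+1.
Proof.
have := ltn_ord i; have := ltn_ord j => jt it; rewrite mxE /zcoef.
have -> : (t + i < t)%N = false by lia.
have -> : (t + i <= k)%N by lia.
by have -> : (j.+1 < t)%N by lia.
Qed.

Lemma block22E h (i j : 'I_(k - t + 1)) :
  block22 t k g h i j = zc (t + i)%N (t + j)%N * h (t + i)%N (t + j)%N.
Proof.
have := ltn_ord i; have := ltn_ord j => jt it; rewrite mxE /zcoef.
have -> : (t + i < t)%N = false by lia.
have -> : (t + i <= k)%N by lia.
have -> : (t + j < t)%N = false by lia.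
by case: leqP => // ij; rewrite /phi_quot big_geq ?mul1r // leq_add2l.
Qed.

Lemma block32E h (i : 'I_(n - k)) (j : 'I_(k - t + 1)) :
  block32 n t k alpha h i j =
  zc (k + i.+1)%N (t + j)%N * h (k + i.+1)%N (t + j)%N.
Proof.
have := ltn_ord j => jt; rewrite mxE /zcoef.
have -> : (k + i.+1 < t)%N = false by lia.
have -> : (k + i.+1 <= k)%N = false by lia.
have -> : (t + j < t)%N = false by lia.
by have -> : (t + j <= k)%N by lia.
Qed.

Lemma zcoef31 p q : (k < p)%N -> (q < t)%N -> zc p q = 0.
Proof.
move=> kp qt; rewrite /zcoef qt.
have -> : (p < t)%N = false by lia.
by have -> : (p <= k)%N = false by lia.
Qed.

Lemma zelisko_i (E : (t - 1 + (k - t + 1 + (n - k)) = n)%N) (H : 'M[Q]_n) :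
  zelisko (Phi_mx n t k phi) H <->
  H \in unitmx /\
  exists (H11 : 'M_(t - 1)) (H12 : 'M_(t - 1, k - t + 1))
         (H13 : 'M_(t - 1, n - k)) (H23 : 'M_(k - t + 1, n - k))
         (H33 : 'M_(n - k)) (h : nat -> nat -> Q),
    H = castsq E
          (block_mx H11 (row_mx H12 H13) (col_mx (block21 t k phi h) 0)
             (block_mx (block22 t k g h) H23 (block32 n t k alpha h) H33)).
Proof.
rewrite (zelisko_Phi _ _ _ _ _ g alpha) //; split=> -[HU]; last first.
  move=> [H11 [H12 [H13 [H23 [H33 [h HE]]]]]]; split=> //.
  rewrite -/(mx_all (fun i j => divides (zc i.+1 j.+1)) H) HE.
  rewrite mx_all_castsq !(mx_all_block, mx_all_row, mx_all_col).
  repeat apply: conj; move=> i j; have := ltn_ord i; have := ltn_ord j => jb ib.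
  - by apply: dvd_zcoef_free; lia.
  - by apply: dvd_zcoef_free; lia.
  - by apply: dvd_zcoef_free; lia.
  (* The middle block starts after [t - 1] rows, so its 0-based row [i] has 1-based index
     [t + i]. *)
  - rewrite block21E (_ : (t - 1 + i).+1 = t + i)%N; last lia.
    by exists (h (t + i)%N j.+1).
  - by rewrite mxE; exists 0; rewrite mulr0.
  - rewrite block22E (_ : (t - 1 + i).+1 = t + i)%N; last lia.
    rewrite (_ : (t - 1 + j).+1 = t + j)%N; last lia.
    by exists (h (t + i)%N (t + j)%N).
  - by apply: dvd_zcoef_free; lia.
  - rewrite block32E (_ : (t - 1 + j).+1 = t + j)%N; last lia.
    (* The first two row blocks have [k] rows in total. *)
    rewrite (_ : (t - 1 + (k - t + 1 + i)).+1 = k + i.+1)%N; last lia.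
    by exists (h (k + i.+1)%N (t + j)%N).
  - by apply: dvd_zcoef_free; lia.
move=> /divides_factor [h hH]; split=> //.
have [A HE] := castsq_surj _ _ _ E H; move: hH; rewrite {}HE mx_all_castsq {HU H}.
rewrite -(submxK A) -(hsubmxK (ursubmx A)) -(vsubmxK (dlsubmx A)).
rewrite -(submxK (drsubmx A)) !(mx_all_block, mx_all_row, mx_all_col).
(* Conditions on the free blocks are dropped; the four kept determine the prescribed blocks and the
   zero block. *)
move=> [[_ _] [[A21 A31] [[A22 _] [A32 _]]]].
exists (ulsubmx A), (lsubmx (ursubmx A)), (rsubmx (ursubmx A)).
exists (ursubmx (drsubmx A)), (drsubmx (drsubmx A)), h.
congr (castsq E (block_mx _ _ (col_mx _ _) (block_mx _ _ _ _)));
  apply/matrixP => i j; have := ltn_ord i; have := ltn_ord j => jb ib.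
- by rewrite A21 block21E (_ : (t - 1 + i).+1 = t + i)%N; last lia.
- by rewrite A31 zcoef31 ?mul0r ?mxE //; lia.
- rewrite A22 block22E (_ : (t - 1 + i).+1 = t + i)%N; last lia.
  by rewrite (_ : (t - 1 + j).+1 = t + j)%N; last lia.
- rewrite A32 block32E (_ : (t - 1 + j).+1 = t + j)%N; last lia.
  by rewrite (_ : (t - 1 + (k - t + 1 + i)).+1 = k + i.+1)%N; last lia.
Qed.

Lemma zelisko_ii (E : (k - t + 1 + (n - k) = n)%N) (H : 'M[Q]_n) :
  t = 1%N ->
  zelisko (Phi_mx n t k phi) H <->
  H \in unitmx /\
  exists (H23 : 'M_(k - t + 1, n - k)) (H33 : 'M_(n - k)) (h : nat -> nat -> Q),
    H = castsq E
          (block_mx (block22 t k g h) H23 (block32 n t k alpha h) H33).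
Proof.
(* For [t = 1] no rows precede the middle block, and passing to 1-based indices is the shift by
   [t]. *)
move=> t1; have tS i : i.+1 = (t + i)%N by lia.
rewrite (zelisko_Phi _ _ _ _ _ g alpha) //; split=> -[HU]; last first.
  move=> [H23 [H33 [h HE]]]; split=> //.
  rewrite -/(mx_all (fun i j => divides (zc i.+1 j.+1)) H) HE.
  rewrite mx_all_castsq mx_all_block.
  repeat apply: conj; move=> i j; have := ltn_ord i; have := ltn_ord j => jb ib.
  - by rewrite block22E (tS i) (tS j); exists (h (t + i)%N (t + j)%N).
  - by apply: dvd_zcoef_free; lia.
  - rewrite block32E (tS j) (_ : (k - t + 1 + i).+1 = k + i.+1)%N; last lia.
    by exists (h (k + i.+1)%N (t + j)%N).
  - by apply: dvd_zcoef_free; lia.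
move=> /divides_factor [h hH]; split=> //.
have [A HE] := castsq_surj _ _ _ E H; move: hH; rewrite {}HE mx_all_castsq {HU H}.
rewrite -(submxK A) mx_all_block => -[[A22 _] [A32 _]].
exists (ursubmx A), (drsubmx A), h.
congr (castsq E (block_mx _ _ _ _));
  apply/matrixP => i j; have := ltn_ord i; have := ltn_ord j => jb ib.
- by rewrite A22 block22E (tS i) (tS j).
- by rewrite A32 block32E (tS j) (_ : (k - t + 1 + i).+1 = k + i.+1)%N; last lia.
Qed.

Lemma zelisko_iii (E : (k - t + 1 = n)%N) (H : 'M[Q]_n) :
  t = 1%N ->
  zelisko (Phi_mx n t k phi) H <->
  H \in unitmx /\ exists h : nat -> nat -> Q, H = castsq E (block22 t k g h).
Proof.
move=> t1; have tS i : i.+1 = (t + i)%N by lia.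
rewrite (zelisko_Phi _ _ _ _ _ g alpha) //; split=> -[HU]; last first.
  move=> [h HE]; split=> //.
  rewrite -/(mx_all (fun i j => divides (zc i.+1 j.+1)) H) HE.
  rewrite mx_all_castsq => i j.
  by rewrite block22E (tS i) (tS j); exists (h (t + i)%N (t + j)%N).
move=> /divides_factor [h hH]; split=> //.
have [A HE] := castsq_surj _ _ _ E H; move: hH; rewrite {}HE mx_all_castsq {HU H}.
move=> A22; exists h; congr (castsq E _); apply/matrixP => i j.
by rewrite A22 block22E (tS i) (tS j).
Qed.

Lemma zelisko_iv (E : (t - 1 + (k - t + 1) = n)%N) (H : 'M[Q]_n) :
  zelisko (Phi_mx n t k phi) H <->
  H \in unitmx /\
  exists (H11 : 'M_(t - 1)) (H12 : 'M_(t - 1, k - t + 1)) (h : nat -> nat -> Q),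
    H = castsq E (block_mx H11 H12 (block21 t k phi h) (block22 t k g h)).
Proof.
rewrite (zelisko_Phi _ _ _ _ _ g alpha) //; split=> -[HU]; last first.
  move=> [H11 [H12 [h HE]]]; split=> //.
  rewrite -/(mx_all (fun i j => divides (zc i.+1 j.+1)) H) HE.
  rewrite mx_all_castsq mx_all_block.
  repeat apply: conj; move=> i j; have := ltn_ord i; have := ltn_ord j => jb ib.
  - by apply: dvd_zcoef_free; lia.
  - by apply: dvd_zcoef_free; lia.
  - rewrite block21E (_ : (t - 1 + i).+1 = t + i)%N; last lia.
    by exists (h (t + i)%N j.+1).
  - rewrite block22E (_ : (t - 1 + i).+1 = t + i)%N; last lia.
    rewrite (_ : (t - 1 + j).+1 = t + j)%N; last lia.
    by exists (h (t + i)%N (t + j)%N).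
move=> /divides_factor [h hH]; split=> //.
have [A HE] := castsq_surj _ _ _ E H; move: hH; rewrite {}HE mx_all_castsq {HU H}.
rewrite -(submxK A) mx_all_block => -[_ [A21 A22]].
exists (ulsubmx A), (ursubmx A), h.
congr (castsq E (block_mx _ _ _ _));
  apply/matrixP => i j; have := ltn_ord i; have := ltn_ord j => jb ib.
- by rewrite A21 block21E (_ : (t - 1 + i).+1 = t + i)%N; last lia.
- rewrite A22 block22E (_ : (t - 1 + i).+1 = t + i)%N; last lia.
  by rewrite (_ : (t - 1 + j).+1 = t + j)%N; last lia.
Qed.

End ZeliskoBlocks.

(** * Form (v) and the final assembly *)

Lemma unitmx_ublock (Q : comUnitRingType) (n1 n2 : nat) (A : 'M[Q]_n1)
    (B : 'M[Q]_(n1, n2)) (D : 'M[Q]_n2) :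
  (block_mx A B 0 D \in unitmx) = (A \in unitmx) && (D \in unitmx).
Proof. by rewrite !unitmxE det_ublock unitrM. Qed.

Lemma zelisko_pid (Q : comUnitRingType) (n s : nat) (E : (s + (n - s) = n)%N)
    (H : 'M[Q]_n) :
  stable_range_1 Q ->
  zelisko (pid_mx s) H <->
  H \in unitmx /\
  exists (M11 : 'M_s) (M12 : 'M_(s, n - s)) (M22 : 'M_(n - s)),
    [/\ M11 \in unitmx, M22 \in unitmx & H = castsq E (block_mx M11 M12 0 M22)].
Proof.
move=> sr1.
have -> : pid_mx s = diag_mx (\row_(i < n) (i < s)%:R) :> 'M[Q]_n.
  by apply/matrixP => i j; rewrite !mxE -val_eqE; case: eqP; rewrite ?mulr1n ?mulr0n.
rewrite zelisko_diag //; split=> -[HU].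
  have [A HE] := castsq_surj _ _ _ E H => dvdA; split=> //.
  have {}dvdA : mx_all (fun i j x => divides (i < s)%:R (x * (j < s)%:R)) H.
    by move=> i j; have := dvdA i j; rewrite !mxE.
  move: dvdA; rewrite HE mx_all_castsq -(submxK A) mx_all_block => -[_ [A21 _]].
  (* Here row [s + i] of [Phi] has diagonal entry 0 and column [j] has 1, so 0 divides the entry of
     [H]. *)
  have A21_0 : dlsubmx A = 0.
    apply/matrixP => i j; have [y] := A21 i j.
    by rewrite ltn_ord mulr1 ltnNge leq_addr mul0r => ->; rewrite mxE.
  have AE : A = block_mx (ulsubmx A) (ursubmx A) 0 (drsubmx A).
    by rewrite -[LHS]submxK A21_0.
  exists (ulsubmx A), (ursubmx A), (drsubmx A); rewrite -AE.
  (* The determinant is the product of those of the diagonal blocks, so both are invertible. *)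
  by move: HU; rewrite {1}HE unitmx_castsq {1}AE unitmx_ublock submxK => /andP[].
move=> [M11 [M12 [M22 [_ _ HE]]]]; split=> //.
have : mx_all (fun i j x => divides (i < s)%:R (x * (j < s)%:R)) H.
  rewrite HE mx_all_castsq mx_all_block; repeat apply: conj; move=> i j; rewrite ?ltn_ord.
  - by exists (M11 i j * 1); rewrite mul1r.
  - by eexists; rewrite mul1r.
  - by exists 0; rewrite mxE mul0r mulr0.
  - by exists 0; rewrite [(s + j < s)%N]ltnNge leq_addr !mulr0.
by move=> dvdH i j; rewrite !mxE; apply: dvdH.
Qed.

Theorem theorem1 (R : idomainType) (hbez : bezout R)
    (hsr : stable_range_1_5 R) (m : R) (m0 : m != 0)
    (mU : m \isn't a GRing.unit) :
  (forall (n t k : nat) (hn : (2 <= n)%N) (ht : (1 <= t)%N)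
      (htk : (t <= k)%N) (hkn : (k <= n)%N) (phi : nat -> Rmod mU)
      (hphi : forall i, (t <= i < k)%N -> divides (phi i) (phi i.+1))
      (hphik : phi k != 0) (hphit : phi t \isn't a GRing.unit)
      (g : nat -> Rmod mU)
      (hg : forall i, (t <= i < k)%N ->
              generating_solution (phi i) (phi i.+1) (g i))
      (alpha : nat -> Rmod mU)
      (halpha : forall j, (t <= j <= k)%N ->
                  ann_generator (phi j) (alpha j)),
    [/\ forall (lt1t : (1 < t)%N) (ltkn : (k < n)%N) (H : 'M[Rmod mU]_n),
          zelisko (Phi_mx n t k phi) H <->
          H \in unitmx /\
          exists (H11 : 'M_(t - 1)) (H12 : 'M_(t - 1, k - t + 1))
                 (H13 : 'M_(t - 1, n - k)) (H23 : 'M_(k - t + 1, n - k))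
                 (H33 : 'M_(n - k)) (h : nat -> nat -> Rmod mU),
            H = castsq (size_i lt1t htk ltkn)
                  (block_mx H11 (row_mx H12 H13)
                     (col_mx (block21 t k phi h) 0)
                     (block_mx (block22 t k g h) H23
                               (block32 n t k alpha h) H33)),
        forall (eqt1 : t = 1%N) (ltkn : (k < n)%N) (H : 'M[Rmod mU]_n),
          zelisko (Phi_mx n t k phi) H <->
          H \in unitmx /\
          exists (H23 : 'M_(k - t + 1, n - k)) (H33 : 'M_(n - k))
                 (h : nat -> nat -> Rmod mU),
            H = castsq (size_ii eqt1 htk ltkn)
                  (block_mx (block22 t k g h) H23
                            (block32 n t k alpha h) H33),
        forall (eqt1 : t = 1%N) (eqkn : k = n) (H : 'M[Rmod mU]_n),
          zelisko (Phi_mx n t k phi) H <->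
          H \in unitmx /\
          exists h : nat -> nat -> Rmod mU,
            H = castsq (size_iii eqt1 htk eqkn) (block22 t k g h)
      & forall (lt1t : (1 < t)%N) (eqkn : k = n) (H : 'M[Rmod mU]_n),
          zelisko (Phi_mx n t k phi) H <->
          H \in unitmx /\
          exists (H11 : 'M_(t - 1)) (H12 : 'M_(t - 1, k - t + 1))
                 (h : nat -> nat -> Rmod mU),
            H = castsq (size_iv lt1t htk eqkn)
                  (block_mx H11 H12 (block21 t k phi h) (block22 t k g h))]) /\
  (forall (n s : nat) (hn : (2 <= n)%N) (hs : (1 <= s)%N) (hsn : (s < n)%N)
      (H : 'M[Rmod mU]_n),
    zelisko (pid_mx s) H <->
    H \in unitmx /\
    exists (M11 : 'M_s) (M12 : 'M_(s, n - s)) (M22 : 'M_(n - s)),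
      [/\ M11 \in unitmx, M22 \in unitmx &
          H = castsq (size_v hsn) (block_mx M11 M12 0 M22)]).
Proof.
have sr1 := stable_range_1_Rmod _ _ mU hbez hsr m0.
split=> [n t k _ ht htk hkn phi _ _ _ g hg alpha halpha|n s _ _ hsn H]; last first.
  exact: zelisko_pid.
(* The representation defining [alpha j] is turned into the annihilator property that the block
   lemmas take as hypothesis. *)
have annP j x : (t <= j <= k)%N -> x * phi j = 0 <-> divides (alpha j) x.
  by move=> jtk; apply: ann_generatorP => //; apply: halpha.
split=> [lt1t ltkn|eqt1 ltkn|eqt1 eqkn|lt1t eqkn] H.
- exact: zelisko_i.
- exact: zelisko_ii.
- exact: (zelisko_iii _ _ _ _ _ g alpha).
- exact: (zelisko_iv _ _ _ _ _ g alpha).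
Qed.
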